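(* Let $\mathbf{M}\subseteq\Sigma^*$ be any language, let $\mathbf{t}$ be an input-altering transducer over $\Sigma$, and let $L\subseteq\mathbf{M}$ be a $\mathbf{t}$-independent language. If $\mathbf{t}$ is smooth and there is $i\in\mathbb{N}_0$ such that $\mu^{i+1}L=\mu^iL$, then $\mu^iL$ contains $L$ and is maximal $\mathbf{t}$-independent (relative to $\mathbf{M}$).
   Context: $\mathbb{N}_0$ is the set of nonnegative integers. $\Sigma$ is an alphabet (finite nonempty set), $\Sigma^*$ the set of all words over it, and $\mathbf{M}\subseteq\Sigma^*$ a fixed language. A transducer $\mathbf{t}$ over $\Sigma$ is a finite transducer $(Q,\Sigma,T,I,F)$ with finite transition set $T\subseteq Q\times\Sigma^*\times\Sigma^*\times Q$ and sets $I,F\subseteq Q$ of initial and final states; it realizes the relation $R(\mathbf{t})\subseteq\Sigma^*\times\Sigma^*$ of labels of its accepting paths. Write $y\in\mathbf{t}(x)$ iff $(x,y)\in R(\mathbf{t})$, $\mathbf{t}(X)=\bigcup_{x\in X}\mathbf{t}(x)$ for a language $X$, and $\mathbf{t}^{-1}$ for the transducer realizing the inverse relation. $\mathbf{t}$ is input-altering if $w\notin\mathbf{t}(w)$ for all words $w$. A language $L$ is $\mathbf{t}$-independent if $\mathbf{t}(L)\cap L=\emptyset$. A $\mathbf{t}$-independent $L\subseteq\mathbf{M}$ is maximal $\mathbf{t}$-independent (relative to $\mathbf{M}$) if $L\cup\{w\}$ is not $\mathbf{t}$-independent for every $w\in\mathbf{M}\setminus L$. For any language $X$: $\mathrm{I}(X)=\mathbf{M}\setminus(\mathbf{t}(X)\cup\mathbf{t}^{-1}(X))$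 and $\mu X=\mathrm{I}(X)\setminus\mathbf{t}^{-1}(\mathrm{I}(X))$. For a language operator $\mathrm{Op}$: $\mathrm{Op}^0(X)=X$, $\mathrm{Op}^{i+1}(X)=\mathrm{Op}(\mathrm{Op}^i(X))$, $\mathrm{Op}^*(X)=\bigcup_{i\ge0}\mathrm{Op}^i(X)$, $\mathrm{Op}^\cap(X)=\bigcap_{i\ge1}\mathrm{Op}^i(X)$. For each language $X$, $\sigma_X$ is the language operator $\sigma_X(A)=\mathbf{t}^{-1}(A)\cap\mathrm{I}(X)$. $\mathbf{t}$ is smooth if $\sigma_X^\cap(\mathrm{I}(X))\subseteq\sigma_X^*(\mu X)$ for every language $X$. *)

(* Defs.v *)
From mathcomp Require Import all_boot.
From mathcomp Require Import finmap.
From mathcomp Require Import classical_sets.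

Set Implicit Arguments.
Unset Strict Implicit.
Unset Printing Implicit Defensive.

Local Open Scope classical_set_scope.

Notation language Sigma := (set (seq Sigma)).

Record transducer (Sigma : finType) := Transducer {
  state : finType;
  trans : {fset state * seq Sigma * seq Sigma * state};
  init : {set state};
  final : {set state}
}.

(* [run t p x y q]: some path of [t] from [p] to [q] has label [(x, y)]; the
   path without transitions has label [([::], [::])]. *)
Inductive run (Sigma : finType) (t : transducer Sigma) :
    state t -> seq Sigma -> seq Sigma -> state t -> Prop :=
| run_nil p : run p [::] [::] p
| run_cons p u v r x y q :
    (p, u, v, r) \in trans t -> run r x y q -> run p (u ++ x) (v ++ y) q.

Definition realizes (Sigma : finType) (t : transducer Sigma) :
    set (seq Sigma * seq Sigma) :=
  [set xy | exists p q : state t,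
    [/\ p \in init t, q \in final t & run p xy.1 xy.2 q]].

Definition tinv (Sigma : finType) (t : transducer Sigma) : transducer Sigma :=
  @Transducer Sigma (state t)
    [fset (e.1.1.1, e.1.2, e.1.1.2, e.2) | e in trans t]%fset
    (init t) (final t).

Lemma realizes_tinv (Sigma : finType) (t : transducer Sigma)
    (x y : seq Sigma) :
  realizes (tinv t) (x, y) <-> realizes t (y, x).
Proof.
split=> -[p [q [pI qF /= pq]]]; exists p, q; split=> //=.
- elim: pq {pI qF} => [r|p1 u v r a b q1 tr _ IH]; first exact: run_nil.
  have /imfsetP[[[[p2 u2] v2] r2] /= e2 [-> -> -> er]] := tr; subst r.
  exact: run_cons e2 IH.
- elim: pq {pI qF} => [r|p1 u v r a b q1 tr _ IH].
    exact: (@run_nil _ (tinv t)).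
  apply: (@run_cons _ (tinv t) _ _ _ r) IH.
  by apply/imfsetP; exists (p1, u, v, r).
Qed.

Definition tapp (Sigma : finType) (t : transducer Sigma) (X : language Sigma) :
    language Sigma :=
  [set y | exists2 x, X x & realizes t (x, y)].

Definition input_altering (Sigma : finType) (t : transducer Sigma) : Prop :=
  forall w : seq Sigma, ~ realizes t (w, w).

Definition independent (Sigma : finType) (t : transducer Sigma)
    (L : language Sigma) : Prop :=
  tapp t L `&` L = set0.

Definition maximal_independent (Sigma : finType) (M : language Sigma)
    (t : transducer Sigma) (L : language Sigma) : Prop :=
  [/\ L `<=` M, independent t L &
      forall w : seq Sigma, (M `\` L) w -> ~ independent t (L `|` [set w])].

Definition indep_words (Sigma : finType) (M : language Sigma)
    (t : transducer Sigma) (X : language Sigma) : language Sigma :=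
  M `\` (tapp t X `|` tapp (tinv t) X).

Definition mu (Sigma : finType) (M : language Sigma) (t : transducer Sigma)
    (X : language Sigma) : language Sigma :=
  indep_words M t X `\` tapp (tinv t) (indep_words M t X).

Definition op_star (Sigma : finType) (Op : language Sigma -> language Sigma)
    (X : language Sigma) : language Sigma :=
  \bigcup_(i in [set: nat]) iter i Op X.

Definition op_cap (Sigma : finType) (Op : language Sigma -> language Sigma)
    (X : language Sigma) : language Sigma :=
  \bigcap_(i in [set i : nat | 1 <= i]) iter i Op X.

Definition sigma (Sigma : finType) (M : language Sigma) (t : transducer Sigma)
    (X A : language Sigma) : language Sigma :=
  tapp (tinv t) A `&` indep_words M t X.

Definition smooth (Sigma : finType) (M : language Sigma)
    (t : transducer Sigma) : Prop :=
  forall X : language Sigma,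
    op_cap (sigma M t X) (indep_words M t X) `<=`
    op_star (sigma M t X) (mu M t X).

(* Main.v *)
(** For an independent [X] contained in [M], [mu X] is again an independent
    subset of [M] containing [X], and a maximal one as soon as [I(X)] is
    contained in [X]. Let [Y] be a fixed point of [mu], and let [w] be a word
    of [I(Y)] outside [Y = mu Y]. Then [w] is sent by [t] into [I(Y)], and in
    fact into [I(Y)] minus [Y] since [I(Y)] avoids [t^-1(Y)]. Hence [w] lies in
    every [sigma_Y^n(I(Y))], and by smoothness in some [sigma_Y^j(Y)]. This is
    impossible, as [sigma_Y(Y)] is empty. *)
Require Import Defs.
From mathcomp Require Import all_boot.
From mathcomp Require Import classical_sets.
From mathcomp Require Import boolp.

Local Open Scope classical_set_scope.

Section Mu.
Set Implicit Arguments.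
Unset Strict Implicit.

Variables (Sigma : finType) (M : set (seq Sigma)) (t : transducer Sigma).
Implicit Types (X Y A : set (seq Sigma)) (w x y : seq Sigma).

Lemma tapp_tinvE X w :
  tapp (tinv t) X w <-> exists2 x, X x & realizes t (w, x).
Proof. by split=> -[x Xx /realizes_tinv wx]; exists x. Qed.

Lemma independentP X :
  independent t X <-> forall x y, X x -> X y -> ~ realizes t (x, y).
Proof.
split=> [X0 x y Xx Xy xy|Xt].
  by have : (tapp t X `&` X) y by [split=> //; exists x]; rewrite X0.
by apply/seteqP; split=> // y [[x Xx xy] Xy]; exact: Xt xy.
Qed.

(** Independence keeps [X] clear of [t(X)] and [t^-1(X)]; and a word of [X] that [t] sends into
    [I(X)] would put a word of [t(X)] there. *)
Lemma sub_mu X : X `<=` M -> independent t X -> X `<=` mu M t X.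
Proof.
move=> XM /independentP Xt x Xx; split.
  by split=> [|[[y Xy]|/tapp_tinvE[y Xy]]]; [exact: XM|exact: Xt|exact: Xt].
by move=> /tapp_tinvE[y [_ ntX] xy]; apply: ntX; left; exists x.
Qed.

Lemma mu_sub X : mu M t X `<=` M.
Proof. by move=> x [[]]. Qed.

(** A pair of [t] inside [mu X] would have its input in [t^-1(I(X))], which [mu] removes. *)
Lemma mu_independent X : independent t (mu M t X).
Proof.
apply/independentP => x y [_ nx] [Iy _] xy.
by apply: nx; apply/tapp_tinvE; exists y.
Qed.

Lemma iter_mu X i : X `<=` M -> independent t X ->
  [/\ X `<=` iter i (mu M t) X, iter i (mu M t) X `<=` M
    & independent t (iter i (mu M t) X)].
Proof.
move=> XM Xt; elim: i => [|i [XY YM Yt]] /=; first by split.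
split.
- exact: subset_trans XY (sub_mu YM Yt).
- exact: mu_sub.
- exact: mu_independent.
Qed.

Lemma independentU1_indep_words X w :
  M w -> independent t (X `|` [set w]) -> indep_words M t X w.
Proof.
move=> Mw /independentP Xwt; split=> // -[[x Xx]|/tapp_tinvE[x Xx]].
  by apply: Xwt; [left|right].
by apply: Xwt; [right|left].
Qed.

Lemma maximal_independent_indep_words X : X `<=` M -> independent t X ->
  indep_words M t X `<=` X -> maximal_independent M t X.
Proof.
by move=> XM Xt IX; split=> // w [Mw nXw] /(independentU1_indep_words Mw)/IX.
Qed.

Lemma sigma_self X : sigma M t X X = set0.
Proof. by apply/seteqP; split=> // w [tw [_ []]]; right. Qed.

Lemma sigma_set0 X : sigma M t X set0 = set0.
Proof. by apply/seteqP; split=> // w [[]]. Qed.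

(** Only the zeroth iterate survives: the first is already empty, because [I(X)] avoids
    [t^-1(X)]. *)
Lemma op_star_sigma_self X : op_star (sigma M t X) X = X.
Proof.
apply/seteqP; split=> [w [[|j] _]|w Xw]; [by []| |by exists 0].
suff -> : iter j.+1 (sigma M t X) X = set0 by [].
by elim: j => [|j /= ->]; [exact: sigma_self|exact: sigma_set0].
Qed.

(** Makes [I(Y)] minus [Y] a post-fixed point of the monotone [sigma_Y], hence a lower bound for all
    iterates of [sigma_Y] on [I(Y)]. *)
Lemma sub_sigma_indep_words_setD Y : mu M t Y = Y ->
  indep_words M t Y `\` Y `<=` sigma M t Y (indep_words M t Y `\` Y).
Proof.
move=> muY w [Iw nYw]; split=> //.
have /tapp_tinvE[y Iy wy] : tapp (tinv t) (indep_words M t Y) w.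
  by apply: contrapT => ntw; apply: nYw; rewrite -muY.
apply/tapp_tinvE; exists y => //; split=> // Yy.
by case: Iw => _; apply; right; apply/tapp_tinvE; exists y.
Qed.

Lemma sub_sigma X A B : A `<=` B -> sigma M t X A `<=` sigma M t X B.
Proof. by move=> AB w [[x Ax xw] Iw]; split=> //; exists x => //; exact: AB. Qed.

Lemma smooth_mu_fixpoint Y : smooth M t -> mu M t Y = Y ->
  indep_words M t Y `<=` Y.
Proof.
move=> t_smooth muY w Iw; apply: contrapT => nYw; apply: (nYw).
(* Only the seed of the iteration becomes [mu Y], as smoothness requires; the index of [sigma] stays
   [Y]. *)
rewrite -(op_star_sigma_self Y) -{2}muY; apply: t_smooth => n _.
suff /(_ w) : indep_words M t Y `\` Y
    `<=` iter n (sigma M t Y) (indep_words M t Y) by apply.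
elim: n => [|n IHn] /=; first by move=> ? [].
exact: subset_trans (sub_sigma_indep_words_setD muY) (sub_sigma IHn).
Qed.

End Mu.

Theorem theorem11 (Sigma : finType) (Sigma_nonempty : 0 < #|Sigma|)
    (M : set (seq Sigma)) (t : transducer Sigma) (t_alt : input_altering t)
    (L : set (seq Sigma)) (LM : L `<=` M) (L_indep : independent t L)
    (t_smooth : smooth M t) (i : nat)
    (mu_stable : iter i.+1 (mu M t) L = iter i (mu M t) L) :
  L `<=` iter i (mu M t) L /\ maximal_independent M t (iter i (mu M t) L).
Proof.
have [LY YM Yt] := iter_mu i LM L_indep.
split=> //; apply: maximal_independent_indep_words => //.
exact: smooth_mu_fixpoint.
Qed.
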